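(* Let $s\ge 1$ and $k\ge s$ be integers, let $\tau_1,\dots,\tau_k\in[0,1]$ be distinct abscissae and $\omega_1,\dots,\omega_k\in\mathbb{R}$ weights such that the quadrature formula $\int_0^1 g(t)\,\mathrm{d}t\approx\sum_{i=1}^k\omega_i g(\tau_i)$ is exact for all polynomials $g$ of degree at most $2s-1$. Let $A=\mathcal{I}_s\mathcal{P}_s^T\Omega\in\mathbb{R}^{k\times k}$ be the Butcher matrix of the HBVM$(k,s)$ method based at these abscissae. Then the nonzero eigenvalues of $A$ coincide with the eigenvalues of the $s\times s$ tridiagonal matrix $$X_s=\begin{pmatrix}\frac12&-\xi_1&&\\ \xi_1&0&\ddots&\\ &\ddots&\ddots&-\xi_{s-1}\\ &&\xi_{s-1}&0\end{pmatrix},\qquad \xi_j=\frac{1}{2\sqrt{(2j+1)(2j-1)}},\quad j\ge 1,$$ which characterizes the Gauss-Legendre method of order $2s$.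
   Context: For $i\ge1$ let $P_i(t)=\sqrt{2i-1}\,\hat P_{i-1}(t)$, where $\hat P_{i-1}$ is the shifted Legendre polynomial of degree $i-1$ on $[0,1]$; thus $\int_0^1P_i(t)P_j(t)\,\mathrm{d}t=\delta_{ij}$ and $P_i$ has degree $i-1$. Given distinct abscissae $\tau_1,\dots,\tau_k$ and weights $\omega_1,\dots,\omega_k$, set $\Omega=\mathrm{diag}(\omega_1,\dots,\omega_k)$ and define $\mathcal{I}_s,\mathcal{P}_s\in\mathbb{R}^{k\times s}$ by $$(\mathcal{I}_s)_{ij}=\int_0^{\tau_i}P_j(x)\,\mathrm{d}x,\qquad(\mathcal{P}_s)_{ij}=P_j(\tau_i),\qquad i=1,\dots,k,\ j=1,\dots,s.$$ The method HBVM$(k,s)$ (Hamiltonian Boundary Value Method with $k$ steps and degree $s$) based at $\{\tau_i\}$ is the $k$-stage Runge-Kutta method with abscissae $\tau_i$, weights $\omega_i$ and Butcher matrix $A=\mathcal{I}_s\mathcal{P}_s^T\Omega$. The phrase ''characterizes the Gauss-Legendre method of order $2s$'' refers to the known fact that, for $X_s$ the matrix displayed in the claim (with $X_1=(\tfrac12)$), the eigenvalues of $X_s$ coincide with those of the Butcher matrix of the $s$-stage Gauss-Legendre collocation Runge-Kutta method, which has order $2s$. Accordingly, the nonzero eigenvalues of $A$ coincide with the eigenvalues of that Gauss-Legendre Butcher matrix. *)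

(* Defs.v *)
From HB Require Import structures.
From mathcomp Require Import all_boot all_order all_algebra.
From mathcomp Require Import complex.
From mathcomp Require Import all_classical all_reals all_analysis.

Set Implicit Arguments.
Unset Strict Implicit.
Unset Printing Implicit Defensive.

Import Order.TTheory GRing.Theory Num.Theory.
Import numFieldNormedType.Exports.

Local Open Scope classical_set_scope.
Local Open Scope ring_scope.

(* \int_0^t p(x) dx, to be used for 0 <= t (the domain is empty if t < 0) *)
Definition int0 (R : realType) (t : R) (p : {poly R}) : R :=
  \int[@lebesgue_measure R]_(x in `[0, t]) p.[x].

(* Rodrigues' formula on [0, 1]: (1 / n!) (d/dt)^n (t^2 - t)^n. The notation
   p^`N(n) already includes the division by n!. The value at 1 is 1. *)
Definition shifted_legendre (R : realType) (n : nat) : {poly R} :=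
  (('X^2 - 'X) ^+ n)^`N(n).

(* Orthonormal family P_1, P_2, ...; the index i is meant to be >= 1. *)
Definition legendreP (R : realType) (i : nat) : {poly R} :=
  Num.sqrt (2 * i - 1)%N%:R *: shifted_legendre R i.-1.

(* Degree <= d is size <= d.+1. *)
Definition quadrature_exact (R : realType) (k d : nat) (tau omega : 'I_k -> R) :=
  forall g : {poly R}, (size g <= d.+1)%N ->
    int0 1 g = \sum_(i < k) omega i * g.[tau i].

(* Column j : 'I_s of the matrices below corresponds to P_(j+1). *)
Definition mxI (R : realType) (k s : nat) (tau : 'I_k -> R) : 'M[R]_(k, s) :=
  \matrix_(i < k, j < s) int0 (tau i) (legendreP R j.+1).

Definition mxP (R : realType) (k s : nat) (tau : 'I_k -> R) : 'M[R]_(k, s) :=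
  \matrix_(i < k, j < s) (legendreP R j.+1).[tau i].

Definition hbvm_butcher (R : realType) (k s : nat) (tau omega : 'I_k -> R) :
    'M[R]_k :=
  mxI s tau *m (mxP s tau)^T *m diag_mx (\row_(i < k) omega i).

Definition xi (R : realType) (j : nat) : R :=
  (2 * Num.sqrt ((2 * j + 1) * (2 * j - 1))%N%:R)^-1.

(* Indices are 0-based: entries (j, j-1) and (j-1, j) are xi_j and - xi_j. *)
Definition mxX (R : realType) (s : nat) : 'M[R]_s :=
  \matrix_(i < s, j < s)
    if (i == 0 :> nat) && (j == 0 :> nat) then 2^-1
    else if i == j.+1 :> nat then xi R i
    else if j == i.+1 :> nat then - xi R j
    else 0.

(* The zeros of a shifted Legendre polynomial all lie in ]0, 1[, so that the
   range condition only serves to make int0 directly applicable. *)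
Definition gauss_abscissae (R : realType) (s : nat) (c : 'I_s -> R) :=
  injective c /\
  forall i, 0 <= c i <= 1 /\ root (shifted_legendre R s) (c i).

Definition lagrange_basis (R : realType) (s : nat) (c : 'I_s -> R) (j : 'I_s) :
    {poly R} :=
  \prod_(m < s | m != j) ((c j - c m)^-1 *: ('X - (c m)%:P)).

Definition collocation_butcher (R : realType) (s : nat) (c : 'I_s -> R) :
    'M[R]_s :=
  \matrix_(i < s, j < s) int0 (c i) (lagrange_basis c j).

(* The spectrum of a real matrix is taken in the complex numbers R[i]. *)
Definition ceigenvalue (R : realType) (n : nat) (M : 'M[R]_n) (z : R[i]) : bool :=
  eigenvalue (map_mx (real_complex R) M) z.

Definition cmultiplicity (R : realType) (n : nat) (M : 'M[R]_n) (z : R[i]) : nat :=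
  mup z (char_poly (map_mx (real_complex R) M)).

(* Main.v *)
Require Import Defs.
From HB Require Import structures.
From mathcomp Require Import all_boot all_order all_algebra.
From mathcomp Require Import complex.
From mathcomp Require Import all_classical all_reals all_analysis.
From mathcomp Require Import ring lra zify.

Set Implicit Arguments.
Unset Strict Implicit.
Unset Printing Implicit Defensive.

Import Order.TTheory GRing.Theory Num.Theory.
Import numFieldNormedType.Exports.

Local Open Scope classical_set_scope.
Local Open Scope ring_scope.

(* The Legendre recurrence gives int_0^t P_j = xi_j P_(j+1) - xi_(j-1) P_(j-1)
   (for j = 1 the second term is + P_1/2), so that the entries of X_s are the
   integrals over [0, 1] of P_i times the antiderivative of P_j. Since these
   products have degree at most 2s - 1, exactness of the quadrature yields
   P_s^T Omega I_s = X_s. Hence A = I_s (P_s^T Omega) has the characteristic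
   polynomial of X_s up to a power of 'X, and X_s is invertible. At the Gauss
   abscissae P_(s+1) vanishes, so that I_s = P_s X_s, whereas interpolation gives
   I_s = A_c P_s for the collocation matrix A_c: P_s conjugates A_c to X_s. *)

(** * Characteristic polynomials of the two products of a pair of matrices *)

(** Both sides come from the determinant of the block matrix [M]: multiplying [M] by a block
    triangular matrix on the right, or on the left, clears its lower left block. *)
Lemma char_poly_mulmxC (R : comNzRingType) m n
    (A : 'M[R]_(m, n)) (B : 'M[R]_(n, m)) :
  'X^n * char_poly (A *m B) = 'X^m * char_poly (B *m A).
Proof.
pose A' := map_mx polyC A; pose B' := map_mx polyC B.
pose M := block_mx ('X%:M : 'M[{poly R}]_m) A' B' (1%:M : 'M[{poly R}]_n).
have detAB : \det M = char_poly (A *m B).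
  have: M *m block_mx 1%:M 0 (- B') 1%:M
        = block_mx (char_poly_mx (A *m B)) A' 0 1%:M.
    rewrite mulmx_block !mulmx1 !mulmx0 mul1mx !add0r subrr mulmxN.
    by rewrite /char_poly_mx map_mxM.
  move/(congr1 determinant); rewrite det_mulmx det_lblock det_ublock !det1.
  by rewrite !mulr1.
have: block_mx 1%:M 0 (- B') 'X%:M *m M
      = block_mx 'X%:M A' 0 (char_poly_mx (B *m A)).
  rewrite mulmx_block !mul1mx !mul0mx !addr0 mulmx1 mulNmx scalar_mxC addNr.
  by rewrite addrC mulNmx /char_poly_mx map_mxM.
move/(congr1 determinant); rewrite det_mulmx det_lblock det_ublock det1 mul1r.
by rewrite !det_scalar detAB.
Qed.

Lemma char_poly_map_mulmxC (R : comNzRingType) (C : nzRingType)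
    (f : {rmorphism R -> C}) m n (A : 'M[R]_(m, n)) (B : 'M[R]_(n, m)) :
  'X^n * char_poly (map_mx f (A *m B)) = 'X^m * char_poly (map_mx f (B *m A)).
Proof.
by rewrite -!map_char_poly -!(map_polyXn f) -!rmorphM char_poly_mulmxC.
Qed.

(** * Shifted Legendre polynomials from Rodrigues' formula *)

(** One derivative lowers the power of X - a by one and leaves a cofactor whose value at a is
    multiplied by the old exponent. *)
Lemma derivn_XsubCM_horner (R : comNzRingType) (a : R) (q : {poly R}) n :
  (('X - a%:P) ^+ n * q)^`(n).[a] = n`!%:R * q.[a].
Proof.
elim: n q => [|n IH] q; first by rewrite expr0 !mul1r.
rewrite derivSn derivM deriv_exp derivXsubC mul1r /=.
have -> : ('X - a%:P) ^+ n *+ n.+1 * q + ('X - a%:P) ^+ n.+1 * q^`()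
  = ('X - a%:P) ^+ n * (q *+ n.+1 + ('X - a%:P) * q^`()).
  by rewrite exprS; ring.
rewrite IH !hornerE subrr mul0r addr0 hornerMn factS natrM.
by rewrite -[q.[a] *+ _]mulr_natl mulrCA mulrA.
Qed.

Section Legendre.
Variable R : realType.

Local Notation L := (shifted_legendre R).
Local Notation W := ('X^2 - 'X : {poly R}).

Lemma shifted_legendreE n : L n = (n`!%:R)^-1 *: (W ^+ n)^`(n).
Proof.
by rewrite nderivn_def -[X in _ *: X]scaler_nat scalerA mulVf ?scale1r//.
Qed.

(** The factorisation forces a and b to be 0 and 1 in some order, so that both endpoint values are
    instances. *)
Lemma shifted_legendre_horner (a b : R) n :
  W = ('X - a%:P) * ('X - b%:P) -> (L n).[a] = (a - b) ^+ n.
Proof.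
move=> WE; rewrite shifted_legendreE WE hornerZ exprMn derivn_XsubCM_horner.
rewrite mulrA mulVf ?mul1r ?pnatr_eq0 -?lt0n ?fact_gt0//.
by rewrite horner_exp !hornerE.
Qed.

Lemma shifted_legendre_at0 n : (L n).[0] = (- 1) ^+ n.
Proof.
by rewrite (@shifted_legendre_horner 0 1) ?sub0r// polyC0 polyC1; ring.
Qed.

Lemma shifted_legendre_at1 n : (L n).[1] = 1.
Proof.
by rewrite (@shifted_legendre_horner 1 0) ?subr0 ?expr1n// polyC1; ring.
Qed.

Lemma size_shifted_legendre n : (size (L n) <= n.+1)%N.
Proof.
have sW : (size W <= 3)%N.
  by rewrite (leq_trans (size_polyD _ _))// size_polyN size_polyX size_polyXn.
have sWn : (size (W ^+ n) <= (2 * n).+1)%N.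
  rewrite (leq_trans (size_poly_exp_leq _ _))// ltnS.
  by rewrite leq_mul2r -subn1 leq_subLR sW orbT.
apply/leq_sizeP => i ni; rewrite coef_nderivn nth_default ?mul0rn//.
by rewrite (leq_trans sWn)//; lia.
Qed.

(** With W = X^2 - X one has W'' = 2 and W'^2 = 4 W + 1, so only powers of W remain. *)
Lemma deriv2_XnBX_exp n :
  (W ^+ n.+2)^`()^`() =
  n.+2%:R *: ((2 * (2 * n + 3))%:R *: W ^+ n.+1 + n.+1%:R *: W ^+ n).
Proof.
have dW : W^`() = 2%:R * 'X - 1 by rewrite derivB derivXn derivX /= mulr_natl.
have ddW : W^`()^`() = 2%:R.
  by rewrite dW derivB -[1]polyC1 derivC subr0 mulr_natl derivMn derivX.
rewrite deriv_exp /= derivMn derivM deriv_exp /= ddW dW.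
rewrite -!mul_polyC !polyC_natr exprS.
move: (W ^+ n) 'X => A x.
rewrite -[_ *+ n.+1]mulr_natl -[_ *+ n.+2]mulr_natl.
rewrite natrM natrD natrM -[n.+2%:R]natr1 -[n.+1%:R]natr1.
by move: (n%:R : {poly R}) => N; ring.
Qed.

(** Differentiate [deriv2_XnBX_exp] n + 1 more times and divide by (n + 2)!. *)
Lemma deriv_shifted_legendre n :
  (L n.+2)^`() = (2 * (2 * n + 3))%:R *: L n.+1 + (L n)^`().
Proof.
rewrite !shifted_legendreE !derivZ -!derivnS 2!derivSn deriv2_XnBX_exp.
rewrite derivnZ derivnD !derivnZ !scalerDr !scalerA !factS !natrM.
have n0 : n`!%:R != 0 :> R by rewrite pnatr_eq0 -lt0n fact_gt0.
have n1 : n.+1%:R != 0 :> R by rewrite pnatr_eq0.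
have n2 : n.+2%:R != 0 :> R by rewrite pnatr_eq0.
congr (_ *: _ + _ *: _); field;
  rewrite n0 nat1r n1 -natrD; exact: n2.
Qed.

End Legendre.

(** * Integrals of polynomials *)

(** Writing integrands as derivatives reduces the linearity of [int0] to the fundamental theorem of
    calculus. *)
Lemma poly_antiderivative (F : numFieldType) (p : {poly F}) :
  exists q, q^`() = p.
Proof.
exists (\poly_(i < (size p).+1) (p`_i.-1 / i%:R)).
apply/polyP => i; rewrite coef_deriv coef_poly ltnS.
have [ip|pi] := ltnP; last by rewrite mul0rn nth_default.
by rewrite -[LHS]mulr_natr /= divfK// pnatr_eq0.
Qed.

Section Integral.
Variable R : realType.
Implicit Types (t : R) (p q : {poly R}).

Lemma int0_deriv t q : 0 <= t -> int0 t q^`() = q.[t] - q.[0].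
Proof.
rewrite le_eqVlt => /predU1P[<-|t0].
  by rewrite subrr /int0 set_itv1 Rintegral_set1.
rewrite /int0 /Rintegral (@continuous_FTC2 _ _ (horner q))//.
- by apply: continuous_in_subspaceT => x _; exact: continuous_horner.
- split.
  + by move=> x _; exact: derivable_horner.
  + by apply: cvg_at_right_filter; exact: continuous_horner.
  + by apply: cvg_at_left_filter; exact: continuous_horner.
- by move=> x _; rewrite -derivE.
Qed.

Lemma int0D t p q : 0 <= t -> int0 t (p + q) = int0 t p + int0 t q.
Proof.
move=> t0; have [P <-] := poly_antiderivative p.
have [Q <-] := poly_antiderivative q.
by rewrite -derivD !int0_deriv// !hornerD; ring.
Qed.

Lemma int0Z t a p : 0 <= t -> int0 t (a *: p) = a * int0 t p.
Proof.
move=> t0; have [P <-] := poly_antiderivative p.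
by rewrite -derivZ !int0_deriv// !hornerZ mulrBr.
Qed.

Lemma int0_sum t (I : finType) (F : I -> {poly R}) : 0 <= t ->
  int0 t (\sum_i F i) = \sum_i int0 t (F i).
Proof.
move=> t0; elim/big_ind2: _ => [|x1 x2 y1 y2 <- <-|//]; last by rewrite int0D.
by rewrite -(scale0r (0 : {poly R})) int0Z// mul0r.
Qed.

Lemma int0_by_parts p q : p.[0] = 0 -> q.[0] = 0 ->
  int0 1 (p^`() * q) + int0 1 (p * q^`()) = p.[1] * q.[1].
Proof.
move=> p0 q0; rewrite -int0D// -derivM int0_deriv// !hornerM p0 q0.
by rewrite mul0r subr0.
Qed.

End Integral.

(** * Antiderivatives and orthogonality of the Legendre polynomials *)

Section LegendreOrthogonality.
Variable R : realType.

Local Notation L := (shifted_legendre R).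

Lemma shifted_legendre0 : L 0 = 1.
Proof. by rewrite /shifted_legendre expr0 nderivn0. Qed.

Lemma shifted_legendre1 : L 1 = 2%:R * 'X - 1.
Proof.
by rewrite /shifted_legendre expr1 nderivn1 derivB derivXn derivX mulr_natl.
Qed.

(** The antiderivative of [L n] vanishing at 0, read off from [deriv_shifted_legendre]. For n = 0 it
    is 'X, as if L_(-1) were - L_0. *)
Definition legendre_int n : {poly R} :=
  if n is n'.+1 then (2 * (2 * n' + 3))%:R^-1 *: (L n'.+2 - L n')
  else 2^-1 *: (L 1 + L 0).

Lemma deriv_legendre_int n : (legendre_int n)^`() = L n.
Proof.
case: n => [|n]; rewrite /legendre_int derivZ.
  rewrite shifted_legendre1 shifted_legendre0 subrK mulr_natl derivMn derivX.
  by rewrite -mulr_natl mulr1 -polyC_natr -mul_polyC -polyCM mulVf// pnatr_eq0.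
by rewrite derivB deriv_shifted_legendre addrK scalerA mulVf ?scale1r//.
Qed.

Lemma legendre_int_at0 n : (legendre_int n).[0] = 0.
Proof.
case: n => [|n]; rewrite hornerZ hornerD ?hornerN !shifted_legendre_at0.
  by rewrite expr1 expr0 addNr mulr0.
by rewrite !exprS !mulN1r opprK subrr mulr0.
Qed.

Lemma legendre_int_at1 n : (legendre_int n).[1] = (n == 0)%:R.
Proof.
case: n => [|n]; rewrite hornerZ hornerD ?hornerN !shifted_legendre_at1.
  by rewrite mulVf// pnatr_eq0.
by rewrite subrr mulr0.
Qed.

Lemma int0_shifted_legendre n : int0 1 (L n) = (n == 0)%:R.
Proof.
rewrite -deriv_legendre_int int0_deriv//.
by rewrite legendre_int_at0 legendre_int_at1 subr0.
Qed.

Lemma int0_legendre_by_parts m n :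
  int0 1 (L m * legendre_int n) + int0 1 (legendre_int m * L n) =
  ((m == 0) && (n == 0))%:R.
Proof.
have := int0_by_parts (legendre_int_at0 m) (legendre_int_at0 n).
by rewrite !deriv_legendre_int !legendre_int_at1 -natrM mulnb.
Qed.

(* Integration by parts expresses <L_m, L_(n+2)> by products with
   L_(n+1) and L_n. *)
Lemma shifted_legendre_orthogonal m n :
  int0 1 (L m * L n) = (m == n)%:R / (2 * n + 1)%:R.
Proof.
have int0B (p q : {poly R}) : int0 1 (p - q) = int0 1 p - int0 1 q.
  by rewrite -scaleN1r int0D// int0Z// mulN1r.
have H0 k : int0 1 (L k * L 0) = (k == 0)%:R.
  by rewrite shifted_legendre0 mulr1 int0_shifted_legendre.
(* The recurrence goes back two degrees, so the induction carries two consecutive n; the other index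
   stays free because it gets shifted too. *)
have [] : (forall k, int0 1 (L k * L n) = (k == n)%:R / (2 * n + 1)%:R)
  /\ (forall k, int0 1 (L k * L n.+1) = (k == n.+1)%:R / (2 * n.+1 + 1)%:R);
  last by move=> /(_ m).
elim: n {m} => [|n [IH IH1]].
  split=> [k|k]; first by rewrite H0 mulr1n divr1.
  case: k => [|k].
    by rewrite shifted_legendre0 mul1r int0_shifted_legendre mul0r.
  have := int0_legendre_by_parts k.+1 0; rewrite /= -scalerAl -scalerAr.
  rewrite mulrDr mulrBl !int0Z// int0D// int0B !H0 /= mulr0n addr0 sub0r eqSS.
  case: eqP => [->|_]; last by rewrite mulr0n oppr0 mulr0 addr0 mul0r; lra.
  by rewrite mulr1n; lra.
split=> // -[|k].
  by rewrite shifted_legendre0 mul1r int0_shifted_legendre mul0r.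
have := int0_legendre_by_parts k.+1 n.+1; rewrite /= -scalerAl -scalerAr.
rewrite mulrBr mulrBl !int0Z// !int0B IH !IH1 !eqSS.
have N3 : (2 * (2 * n + 3))%:R != 0 :> R by rewrite pnatr_eq0; lia.
move=> H; have {H} -> : int0 1 (L k.+1 * L n.+2) =
  (k.+1 == n)%:R / (2 * n + 1)%:R - (2 * (2 * n + 3))%:R *
   ((2 * (2 * k + 3))%:R^-1 * ((k.+1 == n)%:R / (2 * n.+1 + 1)%:R
          - (k == n.+1)%:R / (2 * n.+1 + 1)%:R)).
  move/(congr1 ( *%R (2 * (2 * n + 3))%:R)): H; rewrite mulr0 mulrDr mulVKf//.
  by move=> H; apply/eqP; rewrite -subr_eq0 opprB addrA addrAC H.
(* For k + 1 = n the two contributions cancel; for k = n + 1 only the last one survives. *)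
have [<-|kn] := eqVneq k.+1 n.
  have -> : (k == k.+2) = false by lia.
  rewrite mul0r subr0 mul0r mulr1n !(natrM, natrD).
  rewrite -[k.+2%:R]natr1 -[k.+1%:R]natr1.
  have : 0 <= k%:R :> R by [].
  by move: k%:R => K K0; field; do ?[apply/andP; split]; apply: lt0r_neq0; lra.
have [->|_] := eqVneq k n.+1; last by rewrite !mul0r subrr !mulr0 subrr.
rewrite !mul0r !sub0r mulr1n !(natrM, natrD) -[n.+2%:R]natr1 -[n.+1%:R]natr1.
have : 0 <= n%:R :> R by [].
by move: n%:R => K K0; field; do ?[apply/andP; split]; apply: lt0r_neq0; lra.
Qed.

End LegendreOrthogonality.

(** * The orthonormal family and the entries of X_s *)

Lemma sum_mulr_delta (R : nzRingType) s (f : nat -> R) a :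
  \sum_(l < s) f l * (l == a :> nat)%:R = if (a < s)%N then f a else 0.
Proof.
case: ltnP => [ltas|sa].
  rewrite (bigD1 (Ordinal ltas))//= eqxx mulr1 big1 ?addr0// => l.
  by rewrite -val_eqE /= => /negPf ->; rewrite mulr0.
rewrite big1// => l _; rewrite (_ : _ == _ = false) ?mulr0//.
by have := ltn_ord l; lia.
Qed.

Section OrthonormalLegendre.
Variable R : realType.

Local Notation P := (legendreP R).
Local Notation r n := (@Num.sqrt R (2 * n.+1 - 1)%N%:R).

Lemma legendreP_scale_gt0 n : 0 < r n.
Proof. by rewrite sqrtr_gt0 ltr0n; lia. Qed.

Lemma legendreP_scale_sqr n : r n * r n = (2 * n + 1)%:R.
Proof. by rewrite -expr2 sqr_sqrtr//; congr (_%:R); lia. Qed.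

Lemma size_legendreP n : (size (P n.+1) <= n.+1)%N.
Proof.
exact: leq_trans (size_scale_leq _ _) (size_shifted_legendre R n).
Qed.

Lemma legendreP_orthonormal m n : int0 1 (P m.+1 * P n.+1) = (m == n)%:R.
Proof.
rewrite -scalerAl -scalerAr !int0Z// shifted_legendre_orthogonal /=.
have [<-|_] := eqVneq m n; last by rewrite mul0r !mulr0.
by rewrite mulrA legendreP_scale_sqr mulr1n mul1r divff// pnatr_eq0; lia.
Qed.

Lemma int0_legendreP_lin2 (a b : R) i m n :
  int0 1 (P i.+1 * (a *: P m.+1 + b *: P n.+1)) =
  a * (i == m)%:R + b * (i == n)%:R.
Proof.
rewrite mulrDr -[P _ * _]scalerAr -[P _ * (b *: _)]scalerAr.
by rewrite int0D// !int0Z// !legendreP_orthonormal.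
Qed.

Lemma xiE j : xi R j.+1 = (2 * (r j.+1 * r j))^-1.
Proof.
rewrite -sqrtrM//; congr (2 * Num.sqrt _)^-1.
by rewrite -natrM; congr (_%:R); lia.
Qed.

Lemma xi_gt0 j : 0 < xi R j.+1.
Proof. by rewrite xiE invr_gt0 !mulr_gt0// legendreP_scale_gt0. Qed.

(** The antiderivative of [P j.+1] vanishing at 0, in the orthonormal family. Its coefficients form
    column j of X_s, except that in the last column the term in P_(s+1) falls outside the matrix. *)
Definition legendreP_int j : {poly R} :=
  (if j is j'.+1 then - xi R j *: P j else 2^-1 *: P 1) + xi R j.+1 *: P j.+2.

Lemma legendreP_intE j : legendreP_int j = r j *: legendre_int R j.
Proof.
have rn0 n : r n != 0 by rewrite gt_eqF ?legendreP_scale_gt0.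
have r0 : r 0%N = 1 by rewrite sqrtr1.
rewrite /legendreP_int /legendreP; case: j => [|j].
  rewrite /legendre_int !scalerA scalerDr addrC; congr (_ *: _ + _ *: _).
    by rewrite xiE r0; field; exact: (rn0 1%N).
  by rewrite r0 mul1r mulr1.
(* Since [r j.+1] squared is 2 j + 3, all coefficients become rational in the factors [r]. *)
have -> : legendre_int R j.+1 = (2 * (r j.+1 * r j.+1))^-1 *:
    (shifted_legendre R j.+2 - shifted_legendre R j).
  rewrite /legendre_int legendreP_scale_sqr -natrM.
  by congr (_%:R^-1 *: _); lia.
rewrite !scalerA !scalerBr addrC -scaleNr !xiE.
by congr (_ *: _ + _ *: _); field; rewrite !rn0.
Qed.

Lemma deriv_legendreP_int j : (legendreP_int j)^`() = P j.+1.
Proof. by rewrite legendreP_intE derivZ deriv_legendre_int. Qed.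

Lemma int0_legendreP t j : 0 <= t -> int0 t (P j.+1) = (legendreP_int j).[t].
Proof.
move=> t0; rewrite -deriv_legendreP_int int0_deriv// {2}legendreP_intE.
by rewrite hornerZ legendre_int_at0 mulr0 subr0.
Qed.

Lemma size_legendreP_int j : (size (legendreP_int j) <= j.+2)%N.
Proof.
rewrite (leq_trans (size_polyD _ _))// geq_max; apply/andP; split; last first.
  exact: leq_trans (size_scale_leq _ _) (size_legendreP _).
case: j => [|j]; apply: leq_trans (size_scale_leq _ _) _.
  exact: leq_trans (size_legendreP _) _.
exact/leqW/leqW/size_legendreP.
Qed.

(** Orthonormality extracts the coefficients of [legendreP_int j]; the P_(s+1) term of the last
    column is orthogonal to every row. *)
Lemma mxX_int0 s (i j : 'I_s) :
  mxX R s i j = int0 1 (P i.+1 * legendreP_int j).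
Proof.
rewrite mxE /legendreP_int; case: (nat_of_ord j) => [|j'].
  rewrite int0_legendreP_lin2; case: (nat_of_ord i) => [|[|i']] /=;
    by rewrite ?mulr1n ?mulr0n ?mulr1 ?mulr0 ?addr0 ?add0r.
rewrite int0_legendreP_lin2 andbF eqSS [j' == _]eq_sym.
have [->|ij] := eqVneq (nat_of_ord i) j'.+2.
  by rewrite mulr1 (_ : (j'.+2 == j') = false) ?mulr0 ?add0r//; lia.
by rewrite mulr0 addr0; case: eqP => _; rewrite ?mulr1 ?mulr0.
Qed.

(** Serves both the invertibility of X_s and the identity at the Gauss abscissae. The last column
    has no entry below the diagonal, hence the test on [j.+1]. *)
Lemma sum_mulr_mxX s (f : nat -> R) (j : 'I_s) :
  \sum_(l < s) f l * mxX R s l j =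
  (if nat_of_ord j is j'.+1 then - xi R j * f j' else 2^-1 * f 0)
  + (if (j.+1 < s)%N then xi R j.+1 * f j.+1 else 0).
Proof.
have -> : (if (j.+1 < s)%N then xi R j.+1 * f j.+1 else 0) = \sum_(l < s)
    (xi R j.+1 * f l) * (l == j.+1 :> nat)%:R.
  by rewrite (sum_mulr_delta _ (fun l => xi R j.+1 * f l)).
have -> : (if nat_of_ord j is j'.+1 then - xi R j * f j' else 2^-1 * f 0) =
    \sum_(l < s) ((if nat_of_ord j is j'.+1 then - xi R j else 2^-1) * f l)
      * (l == j.-1 :> nat)%:R.
  rewrite (sum_mulr_delta _ (fun l => _ * f l)) (leq_ltn_trans (leq_pred _))//.
  by case: (nat_of_ord j).
rewrite -big_split; apply: eq_bigr => l _ /=; rewrite mxX_int0 /legendreP_int.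
case: (nat_of_ord j) => [|j'] /=; rewrite int0_legendreP_lin2; ring.
Qed.

End OrthonormalLegendre.

(** * Matrix identities and invertibility of X_s *)

Section Matrices.
Variable R : realType.

Local Notation P := (legendreP R).

Lemma trmxP_omega_mxI (k s : nat) (tau omega : 'I_k -> R) :
  (forall i, 0 <= tau i) -> (0 < s)%N ->
  quadrature_exact (2 * s - 1)%N tau omega ->
  ((mxP s tau)^T *m diag_mx (\row_i omega i)) *m mxI s tau = mxX R s.
Proof.
move=> tau0 s0 quad; apply/matrixP => i j; rewrite mxX_int0 quad.
  rewrite mxE; apply: eq_bigr => m _.
  rewrite mul_mx_diag !mxE int0_legendreP// hornerM; ring.
(* The degrees i and j + 1, with i, j <= s - 1, add up to at most 2s - 1. *)
rewrite (leq_trans (size_polyMleq _ _))//.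
have := size_legendreP R i; have := size_legendreP_int R j.
by have := ltn_ord i; have := ltn_ord j; lia.
Qed.

(* Since X_s + X_s^T = e_1 e_1^T, v X_s = 0 forces v_1 = 0, and then the
   tridiagonal recurrence forces all the other coordinates to vanish. *)
Lemma mxX_unit s : mxX R s \in unitmx.
Proof.
case: s => [|s]; first by rewrite unitmxE det_mx00 unitr1.
rewrite unitmxE unitfE; apply/negP => /det0P[v v0 vX].
pose f n := v 0 (inord n).
have col (j : 'I_s.+1) :
    (if nat_of_ord j is j'.+1 then - xi R j * f j' else 2^-1 * f 0)
    + (if (j.+1 < s.+1)%N then xi R j.+1 * f j.+1 else 0) = 0.
  transitivity ((v *m mxX R s.+1) 0 j); last by rewrite vX mxE.
  rewrite -sum_mulr_mxX mxE.
  by apply: eq_bigr => l _; rewrite /f inord_val.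
have symX : mxX R s.+1 + (mxX R s.+1)^T = delta_mx 0 0.
  apply/matrixP => i j; rewrite !mxE -!val_eqE /=.
  have [i0|i0] := eqVneq (nat_of_ord i) 0;
    have [j0|j0] := eqVneq (nat_of_ord j) 0 => /=.
  - by rewrite mulr1n; lra.
  - by rewrite i0 /=; case: eqP => [->|_]; rewrite ?subrr ?addNr ?addr0 ?eqxx.
  - by rewrite j0 /=; case: eqP => [->|_]; rewrite ?subrr ?addNr ?addr0.
  have [ij|ij] := eqVneq (nat_of_ord i) j.+1.
    by rewrite ij (_ : (_ == _) = false) ?subrr//; lia.
  by case: eqP => _; rewrite ?addNr ?addr0.
have f0 : f 0 = 0.
  (* The left side is the square of the first coordinate of [v]. *)
  have vdv : v *m delta_mx 0 0 *m v^T = 0.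
    by rewrite -symX mulmxDr vX add0r -mulmxA -trmx_mul vX trmx0 mulmx0.
  have vd l : (v *m delta_mx 0 0) 0 l = v 0 0 * (l == 0)%:R.
    rewrite mxE (bigD1 0)//= big1 ?addr0 ?mxE// => m /negPf m0.
    by rewrite mxE m0 mulr0.
  have /matrixP/(_ 0 0)/eqP := vdv; rewrite !mxE (bigD1 0)//=.
  rewrite big1 => [|m /negPf m0].
    rewrite vd mxE eqxx mulr1 addr0 mulf_eq0 orbb => /eqP.
    by rewrite /f (_ : inord 0 = 0)//; apply: val_inj; rewrite /= inordK.
  by rewrite vd m0 mulr0 mul0r.
have f_eq0 n : (n < s.+1)%N -> f n = 0.
  elim/ltn_ind: n => -[//|n] IH ns.
  (* Column n links coordinate n + 1, through the nonzero xi_(n+1), only to a coordinate already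
     known to vanish. *)
  have := col (Ordinal (ltnW ns)); rewrite /= ns.
  have -> : (if n is j'.+1 then - xi R n * f j' else 2^-1 * f 0) = 0.
    by case: n IH ns => [|n] IH ns; rewrite ?f0 ?IH ?mulr0//; lia.
  by rewrite add0r => /eqP; rewrite mulf_eq0 gt_eqF ?xi_gt0//= => /eqP.
case/negP: v0; apply/eqP/rowP => i; rewrite mxE -(f_eq0 i (ltn_ord i)).
by rewrite /f inord_val.
Qed.

(** * Collocation at the Gauss abscissae *)

Section Collocation.
Variables (s : nat) (c : 'I_s -> R).
Hypothesis c_inj : injective c.

Lemma lagrange_basis_horner i j : (lagrange_basis c j).[c i] = (i == j)%:R.
Proof.
rewrite /lagrange_basis horner_prod; have [->|ij] := eqVneq i j.
  apply: big1 => m mj; rewrite hornerZ hornerXsubC mulVf// subr_eq0.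
  by rewrite (inj_eq c_inj) eq_sym.
by rewrite (bigD1 i)//= hornerZ hornerXsubC subrr mulr0 mul0r.
Qed.

Lemma size_lagrange_basis j : (size (lagrange_basis c j) <= s)%N.
Proof.
rewrite /lagrange_basis (leq_trans (size_poly_prod_leq _ _))//.
have : (\sum_(m < s | m != j) size ((c j - c m)^-1 *: ('X - (c m)%:P))
        <= \sum_(m < s | m != j) 2)%N.
  apply: leq_sum => m _.
  by rewrite (leq_trans (size_scale_leq _ _))// size_XsubC.
rewrite sum_nat_const cardC1 card_ord; move: (\sum_(m < s | _) _)%N.
by have := ltn_ord j; lia.
Qed.

(** The difference of the two sides has size at most s and vanishes at s distinct points. *)
Lemma lagrange_interpolation (p : {poly R}) : (size p <= s)%N ->
  p = \sum_m p.[c m] *: lagrange_basis c m.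
Proof.
move=> ps; apply/eqP; rewrite -subr_eq0; apply/eqP.
apply: (@roots_geq_poly_eq0 _ _ [seq c i | i <- enum 'I_s]).
- apply/allP => _ /mapP[i _ ->]; rewrite /root hornerD hornerN horner_sum.
  rewrite (bigD1 i)//= hornerZ lagrange_basis_horner eqxx mulr1.
  rewrite big1 ?addr0 ?subrr//.
  by move=> m mi; rewrite hornerZ lagrange_basis_horner eq_sym (negPf mi) mulr0.
- by rewrite map_inj_uniq// enum_uniq.
- rewrite size_map size_enum_ord (leq_trans (size_polyD _ _))// geq_max ps.
  rewrite size_polyN (leq_trans (size_sum _ _ _))//; apply/bigmax_leqP => m _.
  by rewrite (leq_trans (size_scale_leq _ _))// size_lagrange_basis.
Qed.

(** The integrals of P_i against the Lagrange basis form a left inverse: interpolation reproduces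
    P_j, so the product is the Gram matrix of the orthonormal family. *)
Lemma mxP_unit : mxP s c \in unitmx.
Proof.
have /mulmx1_unit[]// : (\matrix_(i, m) int0 1 (P i.+1 * lagrange_basis c m))
    *m mxP s c = 1%:M.
apply/matrixP => i j; rewrite !mxE -val_eqE /= -legendreP_orthonormal.
have Pj : (size (P j.+1) <= s)%N by exact: leq_trans (size_legendreP _ _) _.
rewrite [in RHS](lagrange_interpolation Pj) mulr_sumr int0_sum//.
by apply: eq_bigr => m _; rewrite !mxE -scalerAr int0Z// mulrC.
Qed.

Lemma collocation_mxP : (forall i, 0 <= c i) ->
  collocation_butcher c *m mxP s c = mxI s c.
Proof.
move=> c0; apply/matrixP => i j; rewrite !mxE.
have Pj : (size (P j.+1) <= s)%N by exact: leq_trans (size_legendreP _ _) _.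
rewrite [in RHS](lagrange_interpolation Pj) int0_sum//.
by apply: eq_bigr => m _; rewrite !mxE int0Z// mulrC.
Qed.

Lemma mxP_mxX : gauss_abscissae c -> mxP s c *m mxX R s = mxI s c.
Proof.
move=> [_ cP]; apply/matrixP => i j; have [/andP[ci0 _] rooti] := cP i.
rewrite !mxE int0_legendreP// /legendreP_int hornerD hornerZ.
under eq_bigr do rewrite mxE.
rewrite (sum_mulr_mxX (fun l => (P l.+1).[c i])); congr (_ + _).
  by case: (nat_of_ord j) => [|j']; symmetry; exact: hornerZ.
(* Only the last column leaves a term, xi_s P_(s+1)(c_i), and c_i is a zero of P_(s+1). *)
case: ltnP => // sj.
have js : j.+1 = s by apply/eqP; rewrite eqn_leq sj ltn_ord.
have /eqP rootj : root (shifted_legendre R j.+1) (c i) by rewrite js.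
by rewrite /legendreP hornerZ [X in _ = _ * (_ * X)]rootj !mulr0.
Qed.

(** The two matrices are the products, in either order, of P_s and X_s P_s^-1; both factors are
    square, so the same power of 'X cancels. *)
Lemma collocation_char_poly (C : idomainType) (f : {rmorphism R -> C}) :
  gauss_abscissae c ->
  char_poly (map_mx f (collocation_butcher c)) = char_poly (map_mx f (mxX R s)).
Proof.
move=> gc; have c0 i : 0 <= c i by have [/andP[]] := gc.2 i.
have P_unit := mxP_unit.
have XPP : mxX R s *m invmx (mxP s c) *m mxP s c = mxX R s.
  by rewrite -mulmxA (mulVmx P_unit) mulmx1.
have PXP : mxP s c *m (mxX R s *m invmx (mxP s c)) = collocation_butcher c.
  by rewrite mulmxA (mxP_mxX gc) -(collocation_mxP c0) (mulmxK P_unit).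
have := char_poly_map_mulmxC f (mxP s c) (mxX R s *m invmx (mxP s c)).
rewrite PXP XPP; apply: mulfI.
exact: (monic_neq0 (monicXn C s)).
Qed.

End Collocation.
End Matrices.

(** * Comparison of the spectra *)

Theorem theorem1 (R : realType) (s k : nat) (hs : (1 <= s)%N) (hk : (s <= k)%N)
    (tau omega : 'I_k -> R)
    (htau01 : forall i, 0 <= tau i <= 1)
    (htau : injective tau)
    (hquad : quadrature_exact (2 * s - 1)%N tau omega) :
  (* the nonzero eigenvalues of A are the eigenvalues of X_s ... *)
  (forall z : R[i],
     z != 0 /\ ceigenvalue (hbvm_butcher s tau omega) z <->
     ceigenvalue (mxX R s) z) /\
  (* ... with the same algebraic multiplicities *)
  (forall z : R[i], z != 0 ->
     cmultiplicity (hbvm_butcher s tau omega) z = cmultiplicity (mxX R s) z) /\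
  (* X_s has the spectrum of the s-stage Gauss-Legendre Butcher matrix *)
  (forall c : 'I_s -> R, gauss_abscissae c ->
     forall z : R[i],
       (ceigenvalue (mxX R s) z <-> ceigenvalue (collocation_butcher c) z) /\
       cmultiplicity (mxX R s) z = cmultiplicity (collocation_butcher c) z).
Proof.
have tau0 i : 0 <= tau i by case/andP: (htau01 i).
have charA := char_poly_map_mulmxC (real_complex R) (mxI s tau)
  ((mxP s tau)^T *m diag_mx (\row_i omega i)).
have AE : mxI s tau *m ((mxP s tau)^T *m diag_mx (\row_i omega i)) =
    hbvm_butcher s tau omega by rewrite mulmxA.
rewrite AE in charA.
rewrite (trmxP_omega_mxI tau0 hs hquad) in charA.
(* The powers of 'X in [charA] affect neither roots nor multiplicities away from 0. *)
have rootXn n (z : R[i]) : z != 0 -> ~~ root 'X^n z.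
  by move=> z0; rewrite /root hornerXn expf_neq0.
split=> [z|].
  rewrite /ceigenvalue !eigenvalue_root_char; split=> [[z0]|rX].
    move=> rA; have : root ('X^s * char_poly (map_mx (real_complex R)
      (hbvm_butcher s tau omega))) z by rewrite rootM rA orbT.
    by rewrite charA rootM (negPf (rootXn _ _ z0)).
  have z0 : z != 0.
    (* At 0 the characteristic polynomial is the determinant of X_s up to sign. *)
    apply: contraTneq rX => ->; rewrite /root horner_coef0 char_poly_det.
    rewrite mulf_neq0 ?expf_neq0 ?oppr_eq0 ?oner_eq0//.
    by rewrite det_map_mx fmorph_eq0 -unitfE -unitmxE mxX_unit.
  split=> //; have : root ('X^k * char_poly (map_mx (real_complex R)
    (mxX R s))) z by rewrite rootM rX orbT.
  by rewrite -charA rootM (negPf (rootXn _ _ z0)).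
split=> [z z0|c gc z].
  rewrite /cmultiplicity -(mupMr _ (rootXn s _ z0)) charA mupMr//.
  exact: rootXn.
rewrite /ceigenvalue /cmultiplicity !eigenvalue_root_char.
by rewrite (collocation_char_poly gc.1 (real_complex R) gc).
Qed.
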